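(* Suppose that $\mu_F+\mu_R>0$ and that $H$ is $L_H$-smooth, for some $L_H>0$. Let $x^\star$ and $u^\star$ be the unique solutions to the primal problem $\min_{x\in\mathcal{X}}F(x)+R(x)+H(Kx)$ and the dual problem $\min_{u\in\mathcal{U}}(F+R)^*(-K^*u)+H^*(u)$, respectively. Suppose that $\gamma_k\equiv\gamma\in(0,2/L_F)$ and $\eta\geq\|K\|^2$. Then the PD3O algorithm converges linearly: there exists $\rho\in(0,1]$ such that, for every $k\in\mathbb{N}$, $$\|x^{k+1}-x^\star\|^2\leq(1-\rho)^k\Big(\|\gamma q^0-x^\star+\gamma\nabla F(x^\star)-\gamma K^*(u^0-u^\star)\|^2+\gamma^2\eta\|u^0-u^\star\|^2-\gamma^2\|K^*(u^0-u^\star)\|^2\Big).$$ The PDDY algorithm converges linearly too: there exists $\rho\in(0,1]$ such that, for every $k\in\mathbb{N}$, $$\|x_R^{k+1}-x^\star\|^2\leq4(1-\rho)^k\Big(\|x_R^0-x^\star+\gamma K^*(u^0-u^\star)\|^2+\gamma^2\eta\|u^0-u^\star\|^2-\gamma^2\|K^*(u^0-u^\star)\|^2\Big).$$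
   Context: $\mathcal{X}$ and $\mathcal{U}$ are finite-dimensional real Hilbert spaces, $K:\mathcal{X}\to\mathcal{U}$ is a linear operator with adjoint $K^*$ and operator norm $\|K\|$. $R:\mathcal{X}\to\mathbb{R}\cup\{+\infty\}$ and $H:\mathcal{U}\to\mathbb{R}\cup\{+\infty\}$ are proper, closed, convex functions, and $F:\mathcal{X}\to\mathbb{R}$ is convex and $L_F$-smooth for some $L_F>0$. A function is $L$-smooth if it is differentiable with $L$-Lipschitz gradient. For a function $G$, $\mu_G\geq0$ denotes some constant such that $G$ is $\mu_G$-strongly convex, i.e. $G-\frac{\mu_G}{2}\|\cdot\|^2$ is convex; $G^*$ is the convex conjugate and $\mathrm{prox}_G(z)=\arg\min_{z'}\{G(z')+\frac12\|z-z'\|^2\}$. Standing assumption: there exists $x^\star\in\mathcal{X}$ such that $0\in\nabla F(x^\star)+\partial R(x^\star)+K^*\partial H(Kx^\star)$. Both algorithms use positive stepsizes $(\gamma_k)_{k\in\mathbb{N}}$ and $\eta>0$ with $\eta\geq\|K\|^2$. PD3O algorithm: given $q^0\in\mathcal{X}$, $u^0\in\mathcal{U}$, for $k=0,1,\ldots$ iterate $$x^{k+1}=\mathrm{prox}_{\gamma_k R}\big(\gamma_k(q^k-K^*u^k)\big),\qquad q^{k+1}=\tfrac{1}{\gamma_{k+1}}x^{k+1}-\nabla F(x^{k+1}),$$ $$u^{k+1}=\mathrm{prox}_{H^*/(\gamma_{k+1}\eta)}\Big(u^k+\tfrac1\eta K\big(\tfrac{1}{\gamma_k}x^{k+1}+q^{k+1}-q^k\big)\Big).$$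 PDDY algorithm: given $x_R^0\in\mathcal{X}$, $u^0\in\mathcal{U}$, set $p^0=K^*u^0$ and for $k=0,1,\ldots$ iterate $$u^{k+1}=\mathrm{prox}_{H^*/(\gamma_k\eta)}\big(u^k+\tfrac{1}{\gamma_k\eta}Kx_R^k\big),\qquad p^{k+1}=K^*u^{k+1},\qquad x^{k+1}=x_R^k-\gamma_k(p^{k+1}-p^k),$$ $$x_R^{k+1}=\mathrm{prox}_{\gamma_{k+1}R}\big(x^{k+1}-\gamma_{k+1}\nabla F(x^{k+1})-\gamma_{k+1}p^{k+1}\big).$$ *)

(* Defs.v *)
From HB Require Import structures.
From mathcomp Require Import all_boot all_order all_algebra.
From mathcomp Require Import all_classical all_reals all_analysis.

Set Implicit Arguments.
Unset Strict Implicit.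
Unset Printing Implicit Defensive.

Import Order.TTheory GRing.Theory Num.Theory.
Import numFieldNormedType.Exports.

Local Open Scope classical_set_scope.
Local Open Scope ring_scope.

(* A finite-dimensional real Hilbert space: [Vector] provides the finite
   dimension, and the norm is the one induced by the inner product (which makes
   the latter positive definite).  Completeness is automatic. *)
HB.mixin Record NormedVector_isEuclidean (R : realType) X
    of NormedModule R X & Vector R X := {
  inner : X -> X -> R ;
  innerC : forall x y, inner x y = inner y x ;
  innerP : forall a x y z, inner (a *: x + y) z = a * inner x z + inner y z ;
  inner_norm : forall x, inner x x = `|x| ^+ 2
}.

#[short(type="euclideanType")]
HB.structure Definition Euclidean (R : realType) :=
  { X of NormedModule R X & Vector R X & NormedVector_isEuclidean R X }.

Section Definitions.
Context {R : realType}.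
Implicit Types X U : euclideanType R.

Definition opnorm X U (K : X -> U) : R :=
  sup [set `|K x| | x in [set x | `|x| <= 1]].

Definition adjoint X U (K : X -> U) (Ks : U -> X) : Prop :=
  forall x u, inner (K x) u = inner x (Ks u).

Definition proper_ereal X (f : X -> \bar R) : Prop :=
  (forall x, f x != -oo%E) /\ (exists x, f x \is a fin_num).

Definition convexe X (f : X -> \bar R) : Prop :=
  forall (t : R) (x y : X), 0 <= t <= 1 ->
    (f (t *: x + (1 - t) *: y)%R <= t%:E * f x + (1 - t)%:E * f y)%E.

Definition strongly_convex (mu : R) X (f : X -> \bar R) : Prop :=
  convexe (fun x => f x - (mu / 2 * `|x| ^+ 2)%:E)%E.

(* The Riesz representative of the differential; meaningful only where [f] is
   differentiable. *)
Definition grad X (f : X -> R) (x : X) : X :=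
  get [set g | forall v, 'd f x v = inner g v].

Definition smooth (L : R) X (f : X -> R) : Prop :=
  (forall x, differentiable f x) /\ L.-lipschitz (grad f).

(* For an extended-real-valued function, differentiability everywhere forces
   finiteness everywhere. *)
Definition smoothe (L : R) X (f : X -> \bar R) : Prop :=
  exists2 h : X -> R, f = EFin \o h & smooth L h.

Definition conjugate X (f : X -> \bar R) (v : X) : \bar R :=
  ereal_sup [set ((inner x v)%:E - f x)%E | x in [set: X]].

(* The usual subdifferential for proper [f] (empty where [f] is +oo). *)
Definition subdiff X (f : X -> \bar R) (x : X) : set X :=
  [set g | forall y, (f x + (inner g (y - x)%R)%:E <= f y)%E].

Definition argmin X (f : X -> \bar R) : set X :=
  [set x | forall y, (f x <= f y)%E].

(* The minimizer exists and is unique for proper closed convex [f]. *)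
Definition prox X (f : X -> \bar R) (z : X) : X :=
  get (argmin (fun y => f y + (2^-1 * `|z - y| ^+ 2)%:E)%E).

Definition scalee (c : R) X (f : X -> \bar R) : X -> \bar R :=
  fun x => (c%:E * f x)%E.

Definition primal_obj X U (F : X -> R) (r : X -> \bar R) (H : U -> \bar R)
    (K : X -> U) : X -> \bar R :=
  fun x => ((F x)%:E + r x + H (K x))%E.

Definition dual_obj X U (F : X -> R) (r : X -> \bar R) (H : U -> \bar R)
    (Ks : U -> X) : U -> \bar R :=
  fun u => (conjugate (fun x => (F x)%:E + r x) (- Ks u)%R + conjugate H u)%E.

(* Sequences generated by the algorithm from the initial values q 0 and u 0;
   the value x 0 is irrelevant. *)
Definition PD3O X U (F : X -> R) (r : X -> \bar R) (H : U -> \bar R)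
    (K : X -> U) (Ks : U -> X) (gam : nat -> R) (eta : R)
    (x q : nat -> X) (u : nat -> U) : Prop :=
  forall k : nat,
  [/\ x k.+1 = prox (scalee (gam k) r) (gam k *: (q k - Ks (u k))),
      q k.+1 = (gam k.+1)^-1 *: x k.+1 - grad F (x k.+1) &
      u k.+1 = prox (scalee (gam k.+1 * eta)^-1 (conjugate H))
        (u k + eta^-1 *: K ((gam k)^-1 *: x k.+1 + q k.+1 - q k))].

(* Sequences generated by the algorithm from the initial values xr 0 and u 0;
   the value x 0 is irrelevant. *)
Definition PDDY X U (F : X -> R) (r : X -> \bar R) (H : U -> \bar R)
    (K : X -> U) (Ks : U -> X) (gam : nat -> R) (eta : R)
    (xr x p : nat -> X) (u : nat -> U) : Prop :=
  p 0%N = Ks (u 0%N) /\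
  forall k : nat,
  [/\ u k.+1 = prox (scalee (gam k * eta)^-1 (conjugate H))
        (u k + (gam k * eta)^-1 *: K (xr k)),
      p k.+1 = Ks (u k.+1),
      x k.+1 = xr k - gam k *: (p k.+1 - p k) &
      xr k.+1 = prox (scalee (gam k.+1) r)
        (x k.+1 - gam k.+1 *: grad F (x k.+1) - gam k.+1 *: p k.+1)].

End Definitions.

(* Main.v *)
Require Import Defs.
From mathcomp Require Import all_boot all_order all_algebra.
From mathcomp Require Import all_classical all_reals all_analysis.
From mathcomp Require Import ring lra.

(** Both algorithms are fixed-point iterations, and each admits a Lyapunov
    function of the form
      E(x, u) = |x|^2 + gamma^2 (eta |u|^2 - |K^* u|^2),
    which is nonnegative because eta >= |K|^2.  Here u stands for the dual error
    u_k - us, and x for the error in the combined variable gamma (q_k - K^* u_k)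
    in the case of PD3O, x_{R,k} + gamma K^* u_k in the case of PDDY.

    Writing the optimality conditions of the two proximal steps of an iteration,
    and subtracting those of the solution, one finds exact identities
    ([pd3o_energy], [pddy_energy]): the decrease E_k - E_{k+1} equals
      2 gamma (<dh, du'> + <dx_R, dg> + <dx, df>) - gamma^2 |df|^2
      + gamma^2 |dg + K^* du'|^2 + (a nonnegative term),
    where df, dg, dh are differences of (sub)gradients of F and R and of
    subgradients of H^*, and dx_R, dx are the differences of the points at which
    those of R and F are taken (they coincide for PD3O).  The three scalar
    products are bounded below:
    - <dx, df> >= |df|^2 / L_F by cocoercivity ([cocoercive]), which absorbs
      gamma^2 |df|^2 as gamma L_F < 2 and leaves a positive fraction of <dx, df>;
    - <dx, df> >= muF |dx|^2 and <dx_R, dg> >= mur |dx_R|^2 by strong convexity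
      ([strongly_monotone]);
    - <dh, du'> >= |du'|^2 / L_H, because w is a subgradient of H^* at u
      only if u is the gradient of H at w ([subdiff_conjugate_grad]), and that
      gradient is cocoercive.
    So the decrease dominates a multiple of |dx_R|^2 + |du'|^2 (for PDDY with the
    help of the square |dg + K^* du'|^2), hence a multiple of E_{k+1}; this is E_{k+1} <= (1 - rho) E_k ([pd3o_contraction],
    [pddy_contraction]).  The primal errors are finally controlled by E_k: by
    nonexpansiveness of the proximity operator for PD3O, and with one more loss
    of a constant for PDDY ([pddy_primal_bound]).

    The rest justifies the optimality conditions.  Closed balls of a Euclidean
    space are compact ([closed_ball_compact]), so proximity operators are attained
    and are resolvents of subdifferentials ([prox_subdiff]); the same fact applied
    to minus a linear form gives the Riesz representation ([riesz]), which makes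
    the gradient meaningful.  A point satisfying the standing inclusion is the
    primal solution and its H-subgradient the dual one because both objectives
    grow quadratically away from them ([primal_argmin], [dual_argmin]). *)

Set Implicit Arguments.
Unset Strict Implicit.
Import Order.TTheory GRing.Theory Num.Theory.
Import numFieldNormedType.Exports.

Local Open Scope classical_set_scope.
Local Open Scope ring_scope.

(** * Inner products *)

Section InnerProduct.
Context {R : realType} {X : euclideanType R}.
Implicit Types x y z : X.

Lemma innerDl x y z : inner (x + y) z = inner x z + inner y z.
Proof. by have := innerP 1 x y z; rewrite scale1r mul1r. Qed.

Lemma inner0l z : inner 0 z = 0 :> R.
Proof. by have := innerDl 0 0 z; rewrite addr0; lra. Qed.

Lemma innerZl a x z : inner (a *: x) z = a * inner x z.
Proof. by have := innerP a x 0 z; rewrite addr0 inner0l addr0. Qed.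

Lemma innerNl x z : inner (- x) z = - inner x z.
Proof. by rewrite -scaleN1r innerZl mulN1r. Qed.

Lemma innerDr x y z : inner z (x + y) = inner z x + inner z y.
Proof. by rewrite !(innerC z) innerDl. Qed.

Lemma inner0r z : inner z 0 = 0 :> R.
Proof. by rewrite innerC inner0l. Qed.

Lemma innerZr a x z : inner z (a *: x) = a * inner z x.
Proof. by rewrite !(innerC z) innerZl. Qed.

Lemma innerNr x z : inner z (- x) = - inner z x.
Proof. by rewrite !(innerC z) innerNl. Qed.

Definition innerE :=
  (innerDl, innerDr, innerNl, innerNr, innerZl, innerZr, inner0l, inner0r).

Lemma inner_ge0 x : 0 <= inner x x.
Proof. by rewrite inner_norm sqr_ge0. Qed.

Lemma inner_eq0 x : inner x x = 0 -> x = 0.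
Proof. by rewrite inner_norm => /eqP; rewrite sqrf_eq0 normr_eq0 => /eqP. Qed.

Lemma inner_ext x y : (forall v, inner x v = inner y v) -> x = y.
Proof.
move=> xy; apply/eqP; rewrite -subr_eq0; apply/eqP/inner_eq0.
by rewrite innerDl innerNl xy subrr.
Qed.

Lemma cauchy_schwarz x y : inner x y <= `|x| * `|y|.
Proof.
have [->|x0] := eqVneq x 0; first by rewrite inner0l normr0 mul0r.
have [->|y0] := eqVneq y 0; first by rewrite inner0r normr0 mulr0.
have nx : 0 < `|x| by rewrite normr_gt0.
have ny : 0 < `|y| by rewrite normr_gt0.
have := inner_ge0 (`|y| *: x - `|x| *: y).
rewrite !innerE (innerC y x) !inner_norm => h.
have {}h : `|x| * `|y| * inner x y <= `|x| * `|y| * (`|x| * `|y|) by nra.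
by rewrite ler_pM2l ?mulr_gt0// in h.
Qed.

End InnerProduct.

(** * Compactness in finite dimension *)

Section FiniteDimension.
Import VectorInternalTheory.
Context {R : realType} {X : euclideanType R}.

Lemma rV_linear_continuous (V : normedModType R) n (f : {linear 'rV[R]_n -> V}) :
  continuous f.
Proof.
have -> : (f : _ -> _) =
    \sum_(j < n) (fun v : 'rV[R]_n => v ord0 j *: f (delta_mx 0 j)).
  apply/funext => v; rewrite fct_sumE {1}[v]row_sum_delta linear_sum.
  by apply: eq_bigr => j _; rewrite linearZ.
apply: (@big_ind _ (fun g : 'rV[R]_n -> V => continuous g)) => [|g h cg ch|j _] v.
- exact: cst_continuous.
- by apply: continuousD; [exact: cg|exact: ch].
- by apply: (@cvgZr_tmp _ _ _ (nbhs v) _ (fun w : 'rV[R]_n => w ord0 j));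
    exact: coord_continuous.
Qed.

Lemma v2r_neq0 (x : X) : x != 0 -> v2r x != 0.
Proof. by apply: contra_neq => x0; apply: (@v2r_inj _ X); rewrite x0 linear0. Qed.

(** Equivalence of the Euclidean norm with the sup norm of the coordinates:
    the former attains a positive minimum on the compact unit sphere of the
    latter. *)
Lemma coord_bound : exists2 c : R, 0 < c & forall x : X, `|v2r x| <= c * `|x|.
Proof.
pose S := [set v : 'rV[R]_(dim X) | `|v| = 1].
have cr : continuous (r2v : 'rV[R]_(dim X) -> X) by exact: rV_linear_continuous.
have cS : compact S.
  apply: bounded_closed_compact.
    by exists 1; split=> // M M1 v /= ->; exact: ltW.
  have -> : S = Num.norm @^-1` [set 1 : R] by [].
  apply: preimage_closed; last exact: closed_eq.
  by move=> v _; exact: norm_continuous.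
(* The sphere is empty in dimension 0, where any constant will do. *)
have [S0|/set0P S0] := eqVneq S set0.
  exists 1 => // x; have [->|x0] := eqVneq x 0.
    by rewrite linear0 !normr0 mulr0.
  have : S ((`|v2r x|)^-1 *: v2r x).
    rewrite /S/= normrZ normfV normr_id mulVf// normr_eq0.
    exact: v2r_neq0.
  by rewrite S0.
have [v0 + minv0] : exists2 c, c \in S & forall t, t \in S ->
    `|r2v c : X| <= `|r2v t : X|.
  apply: (compact_EVT_min S0 cS); apply: continuous_subspaceT => v.
  by apply: continuous_comp; [exact: cr|exact: norm_continuous].
rewrite inE /S /= => nv0.
have m0 : 0 < `|r2v v0 : X|.
  rewrite normr_gt0; apply/eqP => e.
  have : v0 = 0 by apply: (@r2v_inj _ X); rewrite e linear0.
  by move=> v00; move: nv0; rewrite v00 normr0 => /eqP; rewrite eq_sym oner_eq0.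
exists (`|r2v v0 : X|^-1); first by rewrite invr_gt0.
move=> x; have [->|x0] := eqVneq x 0; first by rewrite linear0 !normr0 mulr0.
have nx0 : 0 < `|v2r x|.
  by rewrite normr_gt0 v2r_neq0.
have /minv0 : (`|v2r x|)^-1 *: v2r x \in S.
  by rewrite inE /S/= normrZ normfV normr_id mulVf// gt_eqF.
rewrite linearZ/= v2rK normrZ normfV normr_id.
by rewrite ler_pdivlMl// ler_pdivlMl// mulrC.
Qed.

Lemma linear_bounded (V : normedModType R) (f : {linear X -> V}) :
  exists2 C : R, 0 <= C & forall x, `|f x| <= C * `|x|.
Proof.
have [c c0 cP] := coord_bound.
have : continuous (f \o r2v) by exact: rV_linear_continuous.
move=> /linear_bounded_continuous/linear_boundedP/pinfty_ex_gt0[M M0 MP].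
exists (M * c) => [|x]; first by rewrite mulr_ge0 ?ltW.
rewrite -{1}(v2rK x) (le_trans (MP _))// -mulrA ler_wpM2l ?(ltW M0)//.
Qed.

Lemma closed_ball_compact (B : R) : compact [set x : X | `|x| <= B].
Proof.
have [c c0 cP] := coord_bound.
have cr : continuous (r2v : 'rV[R]_(dim X) -> X) by exact: rV_linear_continuous.
have -> : [set x : X | `|x| <= B] = r2v @` [set v | `|r2v v : X| <= B].
  apply/seteqP; split => [x/= xB|_ [v /= vB <-]//].
  by exists (v2r x); rewrite /= v2rK.
apply: continuous_compact.
  exact: continuous_subspaceT.
apply: bounded_closed_compact.
  exists (c * B); split=> [|M cM v /= vB]; first exact: num_real.
  apply: le_trans (ltW cM).
  by rewrite -{1}(r2vK v) (le_trans (cP _))// ler_wpM2l// ltW.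
have -> : [set v | `|r2v v : X| <= B] = (Num.norm \o r2v) @^-1` [set x : R | x <= B].
  by [].
apply: preimage_closed; last exact: closed_le.
by move=> v _; apply: continuous_comp; [exact: cr|exact: norm_continuous].
Qed.

End FiniteDimension.

(** * Attainment of proximal minima *)

(** Letting t tend to 0.  This replaces every one-sided limit taken along a
    segment below: first-order conditions, gradients of convex functions and
    quadratic growth. *)
Lemma le0_of_le_mul (R : realType) (a b : R) :
  (forall t, 0 < t -> t <= 1 -> a <= t * b) -> a <= 0.
Proof.
move=> h; rewrite leNgt; apply/negP => a0.
have b0 : 0 < b by have := h 1 ltr01 (lexx _); rewrite mul1r; exact: lt_le_trans.
have ab0 : 0 < a / (2 * b) by rewrite divr_gt0// mulr_gt0.
have [le1|gt1] := leP (a / (2 * b)) 1.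
  have e : a / (2 * b) * b = a / 2 by field; rewrite gt_eqF.
  by have := h _ ab0 le1; rewrite e; lra.
have := h 1 ltr01 (lexx _); rewrite mul1r.
move: gt1; rewrite ltr_pdivlMr ?mulr_gt0// mul1r; lra.
Qed.

Section Minimization.
Context {R : realType} {X : euclideanType R}.
Implicit Types (f : X -> \bar R) (x y z p g : X).

(** The nonempty sublevel sets of f in A generate a filter, which clusters
    at some p in A by compactness.  Were f y < f p for some y in A, semicontinuity
    would give a neighbourhood of p disjoint from the sublevel set at level
    f y. *)
Lemma lsc_attains_min f (A : set X) x0 : compact A -> lower_semicontinuous f ->
  (forall y, f y != -oo%E) -> A x0 -> f x0 \is a fin_num ->
  exists2 p, A p & forall y, A y -> (f p <= f y)%E.
Proof.
move=> cA lscf fN Ax0 fx0.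
pose B (a : R) := A `&` [set y | f y <= a%:E]%E.
pose F := filter_from [set a | B a !=set0] B.
have FF : ProperFilter F.
  apply: filter_from_proper => //; apply: filter_from_filter.
    by exists (fine (f x0)), x0; split; rewrite //= fineK.
  move=> a b Ba Bb; exists (Num.min a b).
    by rewrite /= /Num.min; case: ifP.
  by move=> y [Ay /=]; rewrite EFin_min le_min => /andP[ya yb].
have FA : F A.
  exists (fine (f x0)); last by move=> y [].
  by exists x0; split; rewrite //= fineK.
have [p [Ap clp]] := cA F FF FA.
exists p => // y Ay; rewrite leNgt; apply/negP => fyp.
have fyfin : f y \is a fin_num.
  by rewrite fin_numE fN/=; apply: contraTN fyp => /eqP ->; rewrite -leNgt leey.
have [|V pV Vgt] := lscf p (fine (f y)); first by rewrite fineK.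
have FB : F (B (fine (f y))).
  by exists (fine (f y)) => //; exists y; split; rewrite //= fineK.
have [w [[_ /= wle] Vw]] := clp _ _ FB pV.
by have := Vgt _ Vw; rewrite ltNge wle.
Qed.

Lemma lsc_scaleD f (c : R) (h : X -> R) : 0 < c -> lower_semicontinuous f ->
  (forall y, f y != -oo%E) -> continuous h ->
  lower_semicontinuous (fun y => c%:E * f y + (h y)%:E)%E.
Proof.
move=> c0 lscf fN ch x a ax.
(* A level b for f at x that leaves room for h to vary: a < c b + h x. *)
have [b bf ab] : exists2 b : R, (b%:E < f x)%E & a - h x < c * b.
  move: ax (fN x); case: (f x) => [s| |//] /=.
    rewrite -EFinM -EFinD lte_fin => ax _.
    have xcs : (a - h x) / c < s by rewrite ltr_pdivrMr//; lra.
    exists (((a - h x) / c + s) / 2); first by rewrite lte_fin; lra.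
    suff : a - h x < c * ((a - h x) / c + s) / 2 by lra.
    by rewrite mulrDr mulrCA divff ?gt_eqF// mulr1; lra.
  move=> _ _; exists ((a - h x + 1) / c); first by rewrite ltry.
  by rewrite mulrCA divff ?gt_eqF// mulr1; lra.
have [V xV Vb] := lscf x b bf.
exists (V `&` [set y | a - c * b < h y]).
  apply: filterI => //; have := ch x; move/cvgr_gt; apply; lra.
move=> y [/Vb + /=].
case: (f y) (fN y) => [s _ /=| _ _ _ /=|//].
  rewrite !lte_fin => bs ah; have : c * b < c * s by rewrite ltr_pM2l.
  by lra.
by rewrite gt0_muley ?lte_fin// addye// ltry.
Qed.

(** A lower bound weak enough to hold for affine minorants and for linear
    forms alike, and strong enough to be beaten by a quadratic term. *)
Definition norm_minorized f := exists C D : R,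
  0 <= C /\ forall y, ((- (C * `|y|) - D)%:E <= f y)%E.

(** The quadratic term dominates the at most linear decrease of f, so that
    minimization may be restricted to a closed ball. *)
Lemma argmin_prox_nonempty f (c : R) z : 0 < c -> proper_ereal f ->
  lower_semicontinuous f -> norm_minorized f ->
  argmin (fun y => c%:E * f y + (2^-1 * `|z - y| ^+ 2)%:E)%E !=set0.
Proof.
move=> c0 [fN [x0 fx0]] lscf [C [D [C0 fCD]]].
set phi := (fun y => _).
have phiN y : phi y != -oo%E.
  by rewrite /phi; case: (f y) (fN y) => [s| |]//; rewrite gt0_muley ?lte_fin.
have phi0 : phi x0 \is a fin_num by rewrite /phi fin_numD fin_numM.
have lscphi : lower_semicontinuous phi.
  apply: lsc_scaleD => // y.
  have cn : `|z - w| @[w --> y] --> `|z - y|.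
    by apply: cvg_norm; apply: cvgB; [exact: cvg_cst|exact: cvg_id].
  by under eq_fun do rewrite expr2; apply: cvgM;
    [exact: cvg_cst|exact: cvgM].
pose s := fine (phi x0).
pose E := `|s + c * D + c * C * `|z| |.
(* On the sublevel set t = |z - y| satisfies t^2 / 2 <= c C t + E, which fails
   as soon as t > 2 c C + 2 + 2 E. *)
pose B := `|z| + (2 * (c * C) + 2 + 2 * E).
have sub y : (phi y <= phi x0)%E -> `|y| <= B.
  move=> le0.
  have : (c%:E * (- (C * `|y|) - D)%:E + (2^-1 * `|z - y| ^+ 2)%:E <= s%:E)%E.
    rewrite /s fineK//; apply: le_trans le0.
    by rewrite leeD2r// lee_pmul2l// lte_fin.
  rewrite -EFinM -EFinD lee_fin => h.
  have tri : `|y| <= `|z| + `|z - y|.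
    by rewrite -{1}(subKr z y); exact: ler_normB.
  have Ege : s + c * D + c * C * `|z| <= E by exact: ler_norm.
  have E0 : 0 <= E by exact: normr_ge0.
  have cC0 : 0 <= c * C by rewrite mulr_ge0// ltW.
  suff : `|z - y| <= 2 * (c * C) + 2 + 2 * E by rewrite /B; lra.
  have : c * C * `|y| <= c * C * (`|z| + `|z - y|) by rewrite ler_wpM2l.
  have t0 := normr_ge0 (z - y); move: (`|z - y|) h t0 => t h t0 h2.
  rewrite leNgt; apply/negP => tbig.
  have {}h : 2^-1 * t ^+ 2 <= (c * C) * t + E.
    rewrite mulrDr in h2; move: h h2 Ege; rewrite mulrDr !mulrN mulrA; lra.
  move: (c * C) cC0 tbig h => k k0 tbig h; nra.
have [p Ap pmin] := @lsc_attains_min phi _ x0 (closed_ball_compact (B := B))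
  lscphi phiN (sub _ (lexx _)) phi0.
exists p => y /=; have [yB|yB] := leP `|y| B; first exact: pmin.
apply: (le_trans (pmin x0 (sub _ (lexx _)))).
by rewrite leNgt; apply/negP => /ltW/sub; rewrite leNgt yB.
Qed.

Lemma convexeP f x y (a b t : R) : convexe f -> f x = a%:E -> f y = b%:E ->
  0 <= t <= 1 -> (f (t *: x + (1 - t) *: y)%R <= (t * a + (1 - t) * b)%:E)%E.
Proof. by move=> /(_ t x y) + fx fy t01 => /(_ t01); rewrite fx fy. Qed.

Lemma segmentE x y (t : R) : t *: y + (1 - t) *: x = x + t *: (y - x).
Proof. by rewrite scalerBl scale1r scalerBr addrCA. Qed.

(** Fermat's rule: comparing the value at p with that at p + t (y - p), convexity
    makes the variation of f at most linear in t while the quadratic term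
    contributes - t <z - p, y - p> up to order t^2. *)
Lemma argmin_prox_subdiff f (c : R) z p : 0 < c -> proper_ereal f -> convexe f ->
  argmin (fun y => c%:E * f y + (2^-1 * `|z - y| ^+ 2)%:E)%E p ->
  subdiff f p (c^-1 *: (z - p)).
Proof.
move=> c0 [fN [x0 fx0]] cvxf pmin y.
have fp : f p \is a fin_num.
  rewrite fin_numE fN/=; apply/eqP => fpy; have := pmin x0.
  rewrite /= fpy gt0_muley ?lte_fin// addye// leye_eq.
  by rewrite -(fineK fx0) -EFinM -EFinD.
have [fy|] := boolP (f y \is a fin_num); last first.
  by rewrite fin_numE fN/= negbK => /eqP ->; rewrite leey.
rewrite -(fineK fp) -(fineK fy) -EFinD lee_fin -subr_le0.
rewrite -(pmulr_rle0 _ c0).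
apply: (@le0_of_le_mul _ _ (2^-1 * `|y - p| ^+ 2)) => t t0 t1.
have t01 : 0 <= t <= 1 by rewrite t1 ltW.
have := pmin (t *: y + (1 - t) *: p); rewrite /= -(fineK fp) => h.
have := convexeP cvxf (esym (fineK fy)) (esym (fineK fp)) t01.
rewrite -(lee_pmul2l _ (_ : 0 < c%:E)%E) ?lte_fin// => h2.
have {h h2} := le_trans h (leeD2r _ h2).
rewrite -!EFinM -!EFinD lee_fin segmentE -!inner_norm => h.
rewrite innerZl !mulrDr mulVKf ?gt_eqF// -(ler_pM2l t0).
by move: h; rewrite !innerE !(innerC z) !(innerC p y) /=; lra.
Qed.

End Minimization.

(** * Subdifferentials, proximity operators and Riesz representation *)

Section Prox.
Context {R : realType} {X : euclideanType R}.
Implicit Types (f : X -> \bar R) (x y z p g : X).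

Lemma proper_EFin (h : X -> R) : proper_ereal (EFin \o h).
Proof. by split=> //; exists 0. Qed.

Lemma subdiff_fin f x g : proper_ereal f -> subdiff f x g -> f x \is a fin_num.
Proof.
move=> [fN [x0 fx0]] /(_ x0); rewrite -(fineK fx0) fin_numE fN /= => h.
by apply: contraTN h => /eqP ->; rewrite addye.
Qed.

Lemma subdiff_minorized f x g : proper_ereal f -> subdiff f x g -> norm_minorized f.
Proof.
move=> pf sfx; have fx := subdiff_fin pf sfx.
exists `|g|, (inner g x - fine (f x)); split=> // y.
apply: le_trans (sfx y); rewrite -(fineK fx) -EFinD lee_fin /= innerDr innerNr.
have := cauchy_schwarz (- g) y; rewrite normrN innerNl; lra.
Qed.

(** The minimum being attained, the choice operator defining prox returns a true
    minimizer, to which Fermat's rule applies. *)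
Lemma prox_subdiff f (c : R) z : 0 < c -> proper_ereal f ->
  lower_semicontinuous f -> convexe f -> norm_minorized f ->
  subdiff f (prox (scalee c f) z) (c^-1 *: (z - prox (scalee c f) z)).
Proof.
move=> c0 pf lscf cvxf mf; apply: argmin_prox_subdiff => //.
by apply: getPex; exact: argmin_prox_nonempty.
Qed.

Lemma lsc_EFin (h : X -> R) : continuous h -> lower_semicontinuous (EFin \o h).
Proof.
move=> ch x a; rewrite /= lte_fin => ax.
exists [set y | a < h y]; first by have := ch x; move/cvgr_gt; exact.
by move=> y /=; rewrite lte_fin.
Qed.

(** The representative of l is the proximity operator of - l at 0, that is, the
    minimizer of |y|^2 / 2 - l y: its first-order condition reads l <= <p, .>,
    and linearity turns this into an equality. *)
Lemma riesz (l : {linear X -> R^o}) : exists g, forall v, l v = inner g v.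
Proof.
have [C C0 lC] := linear_bounded l.
pose f := EFin \o (fun y => - l y).
have pf : proper_ereal f by exact: proper_EFin.
have lf : lower_semicontinuous f.
  apply: lsc_EFin => y; apply: cvgN; move: y; apply: bounded_linear_continuous.
  apply/linear_boundedP; exists C; split; first exact: num_real.
  by move=> M CM x; rewrite (le_trans (lC x))// ler_wpM2r// ltW.
have cf : convexe f.
  move=> t x y _; rewrite /f /= -!EFinM -EFinD lee_fin linearD !linearZ/=.
  by rewrite /GRing.scale/=; lra.
have mf : norm_minorized f.
  exists C, 0; split=> // y; rewrite /f /= lee_fin subr0 lerN2.
  exact: le_trans (ler_norm _) (lC y).
have := prox_subdiff 0 ltr01 pf lf cf mf.
set p := prox _ _; rewrite invr1 scale1r sub0r => sp.
have le v : l v <= inner p v.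
  have := sp (p + v); rewrite /f /= -EFinD lee_fin linearD/=.
  by rewrite [p + v]addrC addrK innerNl; lra.
exists p => v; apply/eqP; rewrite eq_le le/=.
by have := le (- v); rewrite linearN innerNr lerN2.
Qed.

End Prox.

(** * Convex functions with Lipschitz gradient *)

Section Smooth.
Context {R : realType} {X : euclideanType R}.
Implicit Types (f : X -> R) (x y z p g : X).

Lemma gradP f x v : differentiable f x -> 'd f x v = inner (grad f x) v.
Proof.
move=> df; move: v; have [g gP] := riesz ('d f x).
by apply: (@getPex _ [set g | forall v, 'd f x v = inner g v]); exists g.
Qed.

Lemma is_derive_line f x d (t : R) : differentiable f (x + t *: d) ->
  is_derive t (1 : R) (fun s => f (x + s *: d)) (inner (grad f (x + t *: d)) d).
Proof.
move=> df.
have E : (fun h : R => h^-1 *: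
      (((fun s => f (x + s *: d)) \o shift t) (h *: 1) - f (x + t *: d))) =
    (fun h : R => h^-1 *: ((f \o shift (x + t *: d)) (h *: d) - f (x + t *: d))).
  apply/funext => h /=; congr (_ *: (f _ - _)).
  by rewrite scalerDl [h *: 1]mulr1 addrCA.
split.
  by rewrite /derivable E; exact: diff_derivable.
by rewrite /derive E -gradP// -deriveE.
Qed.

Lemma le_of_derive_le_affine (g g' : R -> R) (a M : R) :
  (forall t : R, is_derive t (1 : R) g (g' t)) ->
  (forall t : R, 0 < t < 1 -> g' t <= a + M * t) -> g 1 <= g 0 + a + M / 2.
Proof.
move=> dg gle.
pose phi : R -> R := g - (a \*: id + (M / 2) \*: (id ^+ 2)).
have dphi t : is_derive t (1 : R) phi (g' t - (a + M * t)).
  apply: is_derive_eq; rewrite /GRing.scale /= expr1; lra.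
have phi01 : phi 1 <= phi 0.
  have in01 (s : R) : 0 <= s <= 1 -> s \in `[0, 1] by rewrite in_itv.
  apply: (@ler0_derive1_le_cc _ phi 0 1) => //; rewrite ?in01 ?lexx ?ler01//.
  - move=> t; rewrite in_itv/= => /gle t01.
    by rewrite derive1E (@derive_val _ _ _ _ _ _ _ (dphi t)); lra.
  - apply: continuous_subspaceT => t; apply: differentiable_continuous.
    exact/derivable1_diffP.
have phiE t : phi t = g t - (a * t + M / 2 * t ^+ 2) by [].
by move: phi01; rewrite !phiE expr1n expr0n /=; lra.
Qed.

Lemma smooth_lipschitz L f x y : smooth L f ->
  `|grad f x - grad f y| <= L * `|x - y|.
Proof. by move=> [_ lf]; exact: (lf (x, y)). Qed.

(** Along the segment from x to y the derivative of f differs from its initial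
    value by at most L t |y - x|^2 at time t; integrating yields the bound.  Both
    signs are needed: the upper one is the descent lemma, the lower one makes
    gradients of convex functions subgradients. *)
Lemma descent_abs L f x y : 0 <= L -> smooth L f ->
  `|f y - f x - inner (grad f x) (y - x)| <= L / 2 * `|y - x| ^+ 2.
Proof.
move=> L0 sf; have [df _] := sf; set d := y - x.
have bound (s t : R) : 0 <= t -> `|s| = 1 ->
    s * inner (grad f (x + t *: d)) d <= s * inner (grad f x) d + L * `|d| ^+ 2 * t.
  move=> t0 s1; rewrite -lerBlDl -mulrBr -innerNl -innerDl -innerZl.
  apply: (le_trans (cauchy_schwarz _ _)); rewrite normrZ s1 mul1r.
  have := smooth_lipschitz (x + t *: d) x sf.
  rewrite addrAC subrr add0r normrZ ger0_norm// => h.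
  by have := ler_wpM2r (normr_ge0 d) h; rewrite expr2; lra.
(* The sign s = 1 gives the upper bound and s = -1 the lower one. *)
have one (s : R) : `|s| = 1 ->
    s * f y <= s * f x + s * inner (grad f x) d + L * `|d| ^+ 2 / 2.
  move=> s1.
  have := @le_of_derive_le_affine (fun t => s * f (x + t *: d))
    (fun t => s * inner (grad f (x + t *: d)) d)
    (s * inner (grad f x) d) (L * `|d| ^+ 2).
  rewrite scale1r scale0r addr0 /d subrKC; apply.
    by move=> t; have dl := is_derive_line (df (x + t *: d)); exact: is_deriveZ.
  by move=> t /andP[t0 _]; apply: bound => //; exact: ltW.
have h1 := one 1 (normr1 _); have h2 := one (-1) (normrN1 _).
by rewrite ler_norml; apply/andP; split; lra.
Qed.

Lemma descent L f x y : 0 <= L -> smooth L f ->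
  f y <= f x + inner (grad f x) (y - x) + L / 2 * `|y - x| ^+ 2.
Proof.
by move=> L0 /(descent_abs x y L0); rewrite ler_norml => /andP[_]; lra.
Qed.

Lemma grad_subdiff L f x : 0 <= L -> smooth L f -> convexe (EFin \o f) ->
  subdiff (EFin \o f) x (grad f x).
Proof.
move=> L0 sf cf y; rewrite /= lee_fin -subr_le0.
apply: (@le0_of_le_mul _ _ (L / 2 * `|y - x| ^+ 2)) => t t0 t1.
have t01 : 0 <= t <= 1 by rewrite t1 ltW.
have := @convexeP _ _ _ y x _ _ t cf erefl erefl t01.
rewrite /= lee_fin segmentE => h; rewrite -(ler_pM2l t0).
have := descent_abs x (x + t *: (y - x)) L0 sf.
rewrite ler_norml => /andP[+ _].
rewrite [x + _ - x]addrAC subrr add0r normrZ exprMn innerZr real_normK ?num_real//.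
lra.
Qed.

(** Moving by d / L with d = g - grad f x, the subgradient inequality predicts an
    increase exceeding the first-order one by |d|^2 / L, whereas the descent lemma
    allows only |d|^2 / (2 L). *)
Lemma subdiff_grad L f x g : 0 < L -> smooth L f ->
  subdiff (EFin \o f) x g -> g = grad f x.
Proof.
move=> L0 sf sg; apply/eqP; rewrite -subr_eq0; apply/eqP/inner_eq0.
set d := g - grad f x.
have := sg (x + L^-1 *: d); rewrite /= -EFinD lee_fin.
have := descent x (x + L^-1 *: d) (ltW L0) sf.
rewrite [x + _ - x]addrAC subrr add0r -inner_norm !innerZr innerZl => h1 h2.
have e : L / 2 * (L^-1 * (L^-1 * inner d d)) = L^-1 * inner d d / 2.
  by field; rewrite gt_eqF.
have : L^-1 * inner d d <= 0.
  have : L^-1 * inner d d = L^-1 * inner g d - L^-1 * inner (grad f x) d.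
    by rewrite {1}/d innerDl innerNl mulrBr.
  by move: h1 h2; rewrite e; lra.
rewrite pmulr_rle0 ?invr_gt0// => dd; apply/eqP; rewrite eq_le dd; exact: inner_ge0.
Qed.

(** Compare f at the point y - (grad f y - grad f x) / L reached by a gradient
    step: convexity bounds it below from x, the descent lemma above from y. *)
Lemma subdiff_cocoercive L f x y : 0 < L -> smooth L f -> convexe (EFin \o f) ->
  f x + inner (grad f x) (y - x) + (2 * L)^-1 * `|grad f y - grad f x| ^+ 2 <= f y.
Proof.
move=> L0 sf cf; set d := grad f y - grad f x.
have := grad_subdiff x (ltW L0) sf cf (y - L^-1 *: d).
rewrite /= -EFinD lee_fin.
have := descent y (y - L^-1 *: d) (ltW L0) sf.
rewrite [y - _ - y]addrAC subrr add0r normrN -!inner_norm innerNr innerZr.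
rewrite !innerZr innerZl => h1 h2.
have e : L / 2 * (L^-1 * (L^-1 * inner d d)) = L^-1 * inner d d / 2.
  by field; rewrite gt_eqF.
have e2 : (2 * L)^-1 * inner d d = L^-1 * inner d d / 2.
  by field; rewrite gt_eqF.
have e3 : L^-1 * inner d d = L^-1 * inner (grad f y) d - L^-1 * inner (grad f x) d.
  by rewrite {1}/d innerDl innerNl mulrBr.
have e4 : inner (grad f x) (y - L^-1 *: d - x) =
    inner (grad f x) (y - x) - L^-1 * inner (grad f x) d.
  by rewrite [y - _ - x]addrAC [LHS]innerDr innerNr innerZr.
move: h1 h2; rewrite e e2 e4; lra.
Qed.

(** The Baillon-Haddad inequality, by summing the previous one with its
    symmetric counterpart. *)
Lemma cocoercive L f x y : 0 < L -> smooth L f -> convexe (EFin \o f) ->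
  `|grad f x - grad f y| ^+ 2 <= L * inner (x - y) (grad f x - grad f y).
Proof.
move=> L0 sf cf.
have := subdiff_cocoercive x y L0 sf cf; have := subdiff_cocoercive y x L0 sf cf.
rewrite (distrC (grad f y)) => h1 h2.
rewrite -ler_pdivrMl//.
have e : (2 * L)^-1 = L^-1 / 2 by field; rewrite gt_eqF.
move: h1 h2; rewrite e !innerE !(innerC _ (grad f _)); lra.
Qed.

End Smooth.

(** * Strong convexity *)

Section StrongConvexity.
Context {R : realType} {X : euclideanType R}.
Implicit Types (f : X -> \bar R) (x y g h : X).

(** Apply strong convexity between x and y at time t, bound f there below by the
    subgradient inequality, divide by t and let t tend to 0. *)
Lemma strong_subdiff mu f x y g : proper_ereal f -> strongly_convex mu f ->
  subdiff f x g ->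
  (f x + (inner g (y - x) + mu / 2 * `|y - x| ^+ 2)%:E <= f y)%E.
Proof.
move=> pf scf sg; have fx := subdiff_fin pf sg; have [fN _] := pf.
have [fy|] := boolP (f y \is a fin_num); last first.
  by rewrite fin_numE fN/= negbK => /eqP ->; rewrite leey.
rewrite -(fineK fx) -(fineK fy) -EFinD lee_fin -subr_le0.
apply: (@le0_of_le_mul _ _ (mu / 2 * `|y - x| ^+ 2)) => t t0 t1.
have t01 : 0 <= t <= 1 by rewrite t1 ltW.
have := scf t y x t01; rewrite segmentE => h1.
have := sg (x + t *: (y - x)) => h2.
have := le_trans (leeB h2 (lexx _)) h1.
rewrite -(fineK fx) -(fineK fy) -!(EFinD, EFinN, EFinM) lee_fin /= => h.
rewrite -(ler_pM2l t0); move: h; rewrite -!inner_norm.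
by rewrite !innerE !(innerC x) !(innerC g); lra.
Qed.

Lemma strongly_monotone mu f x y g h : proper_ereal f -> strongly_convex mu f ->
  subdiff f x g -> subdiff f y h -> mu * `|x - y| ^+ 2 <= inner (x - y) (g - h).
Proof.
move=> pf scf sg sh.
have := strong_subdiff y pf scf sg; have := strong_subdiff x pf scf sh.
have fx := subdiff_fin pf sg; have fy := subdiff_fin pf sh.
rewrite -(fineK fx) -(fineK fy) -!EFinD !lee_fin -!inner_norm.
rewrite !innerE !(innerC x) !(innerC g y) !(innerC h y); lra.
Qed.

Lemma argmin_growth f x (c : R) : f x \is a fin_num -> 0 < c ->
  (forall y, (f x + (c * `|y - x| ^+ 2)%:E <= f y)%E) -> argmin f = [set x].
Proof.
move=> fx c0 gr; apply/seteqP; split => [y ymin|_ -> y]; last first.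
  by apply: le_trans (gr y); rewrite leeDl// lee_fin mulr_ge0// ?sqr_ge0// ltW.
have := le_trans (gr y) (ymin x).
rewrite -(fineK fx) -EFinD lee_fin -lerBrDl subrr pmulr_rle0// => le0.
have /eqP : `|y - x| ^+ 2 = 0 by apply/eqP; rewrite eq_le le0 sqr_ge0.
by rewrite sqrf_eq0 normr_eq0 subr_eq0 => /eqP.
Qed.

End StrongConvexity.

(** * Convex conjugates *)

Section Conjugate.
Context {R : realType} {X : euclideanType R}.
Implicit Types (f : X -> \bar R) (x y u v w g : X).

Lemma conjugate_ge f x v : ((inner x v)%:E - f x <= conjugate f v)%E.
Proof. by apply: ereal_sup_ubound; exists x. Qed.

Lemma conjugate_le f v (b : \bar R) :
  (forall x, (inner x v)%:E - f x <= b)%E -> (conjugate f v <= b)%E.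
Proof. by move=> h; apply: ge_ereal_sup => _ [x _ <-]. Qed.

(** The equality case of the Fenchel-Young inequality. *)
Lemma conjugate_subdiff f x g : proper_ereal f -> subdiff f x g ->
  conjugate f g = ((inner x g)%:E - f x)%E.
Proof.
move=> pf sg; have fx := subdiff_fin pf sg.
apply/eqP; rewrite eq_le conjugate_ge andbT; apply: conjugate_le => y.
have := sg y; have [fN _] := pf; rewrite -(fineK fx).
case: (f y) (fN y) => [s _| _ _|//]; last by rewrite leNye.
rewrite -!(EFinD, EFinN) !lee_fin innerDr innerNr !(innerC g); lra.
Qed.

Lemma conjugate_proper f x g : proper_ereal f -> subdiff f x g ->
  proper_ereal (conjugate f).
Proof.
move=> pf sg; have fx := subdiff_fin pf sg; split=> [v|].
  have := conjugate_ge f x v; rewrite -(fineK fx) -EFinN -EFinD.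
  by move=> h; rewrite -ltNye; apply: lt_le_trans h; rewrite ltNyr.
by exists g; rewrite (conjugate_subdiff pf sg) -(fineK fx).
Qed.

Lemma conjugate_lsc f : proper_ereal f -> lower_semicontinuous (conjugate f).
Proof.
move=> [fN _] v a /ereal_sup_gt[_ [x _ <-]] /= ax.
have [fx|] := boolP (f x \is a fin_num); last first.
  by rewrite fin_numE fN/= negbK => /eqP fx; move: ax; rewrite fx.
move: ax; rewrite -(fineK fx) -EFinN -EFinD lte_fin => ax.
exists [set w | a + fine (f x) < inner x w]; last first.
  move=> w /= aw; apply: lt_le_trans (conjugate_ge f x w).
  by rewrite -(fineK fx) -EFinN -EFinD lte_fin; lra.
have [e e0 ee] : exists2 e : R, 0 < e & a + fine (f x) + e * `|x| < inner x v.
  have x1 : 0 < `|x| + 1 by rewrite ltr_wpDl.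
  pose s := inner x v - (a + fine (f x)).
  have s0 : 0 < s by rewrite /s; lra.
  exists (s / (`|x| + 1)); first by rewrite divr_gt0.
  rewrite -ltrBrDl mulrAC ltr_pdivrMr// -/s; nra.
apply/nbhs_normP; exists e => //= w; rewrite /ball_/= => vw.
have := cauchy_schwarz x (v - w); rewrite innerDr innerNr.
have : `|x| * `|v - w| <= e * `|x| by rewrite mulrC ler_wpM2r// ltW.
lra.
Qed.

Lemma conjugate_convex f : proper_ereal f -> convexe (conjugate f).
Proof.
move=> [fN _] t u v /andP[t0 t1]; apply: conjugate_le => x.
have [fx|] := boolP (f x \is a fin_num); last first.
  by rewrite fin_numE fN/= negbK => /eqP ->; rewrite leNye.
have -> : ((inner x (t *: u + (1 - t) *: v))%:E - f x =
  t%:E * ((inner x u)%:E - f x) + (1 - t)%:E * ((inner x v)%:E - f x))%E.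
  rewrite -(fineK fx) -!(EFinN, EFinD, EFinM) !innerE; congr EFin; ring.
apply: leeD; apply: lee_wpmul2l; rewrite ?lee_fin ?subr_ge0//; exact: conjugate_ge.
Qed.

Lemma conjugate_minorized f x g : proper_ereal f -> subdiff f x g ->
  norm_minorized (conjugate f).
Proof.
move=> pf sg; apply: (subdiff_minorized (x := g) (g := x)).
  exact: conjugate_proper pf sg.
move=> v; rewrite (conjugate_subdiff pf sg).
apply: le_trans (conjugate_ge f x v); have fx := subdiff_fin pf sg.
by rewrite -(fineK fx) -!(EFinD, EFinN) lee_fin !innerE !(innerC x); lra.
Qed.

(** The Fenchel-Young inequality for an L-smooth function has a quadratic gap:
    the supremum defining the conjugate is tested at the point that maximizes the
    bound given by the descent lemma.  This is the strong convexity of the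
    conjugate in the form used for uniqueness of the dual solution. *)
Lemma conjugate_growth L (f : X -> R) w u : 0 < L -> smooth L f ->
  ((inner w u - f w + (2 * L)^-1 * `|u - grad f w| ^+ 2)%:E
    <= conjugate (EFin \o f) u)%E.
Proof.
move=> L0 sf; set d := u - grad f w.
apply: le_trans (conjugate_ge _ (w + L^-1 *: d) u).
have := descent w (w + L^-1 *: d) (ltW L0) sf.
rewrite /= -EFinD lee_fin [w + _ - w]addrAC subrr add0r -!inner_norm.
rewrite innerDl !innerZr !innerZl (innerC d u).
have -> : L / 2 * (L^-1 * (L^-1 * inner d d)) = L^-1 * inner d d / 2.
  by field; rewrite gt_eqF.
have -> : (2 * L)^-1 * inner d d = L^-1 * inner d d / 2.
  by field; rewrite gt_eqF.
have : L^-1 * inner d d = L^-1 * inner u d - L^-1 * inner (grad f w) d.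
  by rewrite {1}/d innerDl innerNl mulrBr.
lra.
Qed.

(** Inverting the subdifferential of a conjugate: testing the subgradient
    inequality at grad f w, where the conjugate is known, forces equality in the
    Fenchel-Young inequality for u and w, so u is a subgradient of f at w.  The
    biconjugate theorem is avoided because f has a gradient at w. *)
Lemma subdiff_conjugate_grad L (f : X -> R) u w : 0 < L -> smooth L f ->
  convexe (EFin \o f) -> subdiff (conjugate (EFin \o f)) u w -> u = grad f w.
Proof.
move=> L0 sf cf sw.
have pf := proper_EFin f.
have sg := grad_subdiff w (ltW L0) sf cf.
have := sw (grad f w); rewrite (conjugate_subdiff pf sg).
have cu := subdiff_fin (conjugate_proper pf sg) sw.
rewrite -(fineK cu) -!(EFinD, EFinN) lee_fin !innerE => h.
apply: (subdiff_grad L0 sf) => y.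
have := conjugate_ge (EFin \o f) y u; rewrite -(fineK cu).
rewrite /= -!(EFinD, EFinN) !lee_fin !innerE !(innerC u); lra.
Qed.

End Conjugate.

(** * The adjoint operator *)

Section Adjoint.
Context {R : realType} {X U : euclideanType R}.
Context (K : {linear X -> U}) (Ks : U -> X) (hKs : adjoint K Ks).
Implicit Types (x y : X) (u v : U).

Lemma adjointB u v : Ks (u - v) = Ks u - Ks v.
Proof.
by apply: inner_ext => x; rewrite (innerC _ x) -hKs !innerE !hKs !(innerC x).
Qed.

(** The supremum defining the operator norm is a true upper bound, as linear maps
    on a finite-dimensional space are bounded. *)
Lemma opnorm_ub x : `|x| <= 1 -> `|K x| <= opnorm K.
Proof.
have [C C0 KC] := linear_bounded K => x1; apply: ub_le_sup; last by exists x.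
exists C => _ [y /= y1 <-]; apply: (le_trans (KC y)).
by rewrite -[leRHS]mulr1 ler_wpM2l.
Qed.

Lemma opnorm_bound x : `|K x| <= opnorm K * `|x|.
Proof.
have [->|x0] := eqVneq x 0; first by rewrite linear0 !normr0 mulr0.
have nx : 0 < `|x| by rewrite normr_gt0.
have := @opnorm_ub (`|x|^-1 *: x).
rewrite linearZ/= !normrZ normfV normr_id mulVf ?gt_eqF// lexx => /(_ isT).
by rewrite ler_pdivrMl// mulrC.
Qed.

Lemma adjoint_bound eta u : opnorm K ^+ 2 <= eta ->
  `|Ks u| ^+ 2 <= eta * `|u| ^+ 2.
Proof.
move=> heta; apply: le_trans (ler_wpM2r (sqr_ge0 _) heta).
have K0 : 0 <= opnorm K.
  by rewrite -(normr0 U) -(linear0 K); apply: opnorm_ub; rewrite normr0.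
rewrite -exprMn ler_sqr ?nnegrE ?mulr_ge0//.
have [->|a0] := eqVneq (Ks u) 0; first by rewrite normr0 mulr_ge0.
have na : 0 < `|Ks u| by rewrite normr_gt0.
rewrite -(ler_pM2l na) -expr2 -inner_norm -hKs.
apply: (le_trans (cauchy_schwarz _ _)); rewrite mulrA ler_wpM2r//.
by rewrite mulrC opnorm_bound.
Qed.

End Adjoint.

(** * Lyapunov function and its contraction *)

Section Energy.
Context {R : realType} {X U : euclideanType R}.
Context (K : {linear X -> U}) (Ks : U -> X) (hKs : adjoint K Ks).
Implicit Types (x y : X) (u v : U).

(** The squared seminorm of the error (x, gamma u) in the metric for which both
    algorithms are averaged fixed-point iterations: the dual part is weighted
    by eta - K K^*. *)
Definition energy (gamma eta : R) x u : R :=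
  `|x| ^+ 2 + gamma ^+ 2 * eta * `|u| ^+ 2 - gamma ^+ 2 * `|Ks u| ^+ 2.

(** One iteration of PD3O in terms of errors: x is the new primal error, f and g
    the errors of the gradient of F and the subgradient of R there, u and v the
    old and new dual errors, and h the error of the subgradient of the conjugate
    of H at the new dual point, as given by the dual proximal step. *)
Lemma pd3o_energy gamma eta x f g u v h :
  h = (gamma * eta) *: (u - v) + K (x - gamma *: (f + g + Ks u)) ->
  energy gamma eta (x + gamma *: g) u
    - energy gamma eta (x - gamma *: f - gamma *: Ks v) v =
  2 * gamma * (inner h v + inner x g + inner x f)
  - gamma ^+ 2 * `|f| ^+ 2 + gamma ^+ 2 * `|g + Ks v| ^+ 2
  + gamma ^+ 2 * (eta * `|u - v| ^+ 2 - `|Ks u - Ks v| ^+ 2).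
Proof.
move=> ->; rewrite /energy innerDl hKs.
rewrite -!inner_norm !innerE.
rewrite !(innerC (Ks u)) !(innerC (Ks v)) !(innerC v u).
rewrite ?(innerC g x) ?(innerC f x) ?(innerC g f).
ring.
Qed.

(** One iteration of PDDY in terms of errors: y is the error of the point at
    which F is differentiated and b that of the output of the proximal step on R;
    the other letters are as for PD3O. *)
Lemma pddy_energy gamma eta y f g u v h :
  h = (gamma * eta) *: (u - v) + K (y + gamma *: (Ks v - Ks u)) ->
  let b := y - gamma *: (f + g + Ks v) in
  energy gamma eta (y + gamma *: Ks v) u
    - energy gamma eta (b + gamma *: Ks v) v =
  2 * gamma * (inner h v + inner b g + inner y f)
  - gamma ^+ 2 * `|f| ^+ 2 + gamma ^+ 2 * `|g + Ks v| ^+ 2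
  + gamma ^+ 2 * (eta * `|u - v| ^+ 2 - `|Ks u - Ks v| ^+ 2).
Proof.
move=> -> b; rewrite /energy innerDl hKs /b.
rewrite -!inner_norm !innerE.
rewrite !(innerC (Ks u)) !(innerC (Ks v)) !(innerC v u).
rewrite ?(innerC g y) ?(innerC f y) ?(innerC g f).
ring.
Qed.

Lemma sqr_normD_le x y : `|x + y| ^+ 2 <= 2 * `|x| ^+ 2 + 2 * `|y| ^+ 2.
Proof.
have := inner_ge0 (x - y); rewrite -!inner_norm !innerE (innerC y x); lra.
Qed.

Lemma gradient_step_nonexpansive gamma L x f : 0 <= gamma -> gamma * L <= 2 ->
  0 <= inner x f -> `|f| ^+ 2 <= L * inner x f ->
  `|x - gamma *: f| ^+ 2 <= `|x| ^+ 2.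
Proof.
move=> g0 gL xf0 fL; rewrite -!inner_norm !innerE (innerC f x) !inner_norm.
have h1 : gamma ^+ 2 * `|f| ^+ 2 <= gamma ^+ 2 * (L * inner x f).
  by rewrite ler_wpM2l ?sqr_ge0.
have h2 : gamma * inner x f * (gamma * L) <= gamma * inner x f * 2.
  by rewrite ler_wpM2l// mulr_ge0.
lra.
Qed.

Context (gamma eta : R) (gamma_gt0 : 0 < gamma) (eta_gt0 : 0 < eta)
  (eta_ge : opnorm K ^+ 2 <= eta).

Lemma sqr_norm_le_energy x u : `|x| ^+ 2 <= energy gamma eta x u.
Proof.
rewrite /energy -addrA lerDl -mulrA -mulrBr mulr_ge0 ?sqr_ge0// subr_ge0.
exact: adjoint_bound.
Qed.

Lemma metric_ge0 u v : 0 <= eta * `|u - v| ^+ 2 - `|Ks u - Ks v| ^+ 2.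
Proof. by rewrite -(adjointB hKs) subr_ge0; exact: adjoint_bound. Qed.

(** The term - |K^* v|^2 in the energy cancels half of what separating
    x and c K^* v costs.  The scalar c is plus or minus gamma, according to the
    algorithm. *)
Lemma energy_le x v c : c ^+ 2 = gamma ^+ 2 ->
  energy gamma eta (x + c *: Ks v) v <=
  2 * `|x| ^+ 2 + 2 * gamma ^+ 2 * eta * `|v| ^+ 2.
Proof.
move=> cg; rewrite /energy.
have := sqr_normD_le x (c *: Ks v); rewrite normrZ exprMn real_normK ?num_real// cg.
have := ler_wpM2l (sqr_ge0 gamma) (adjoint_bound hKs v eta_ge).
lra.
Qed.

(** A decrease V - W that dominates both parts N and D of a bound on W is a
    decrease by at least c W, where c = min (kappa / 2, sigma / tau); hence
    rho = c / (1 + c). *)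
Lemma contraction_rate (kappa sigma tau : R) : 0 < kappa -> 0 < sigma -> 0 < tau ->
  exists2 rho : R, 0 < rho <= 1 & forall V W N D : R, 0 <= N -> 0 <= D ->
    W <= 2 * N + tau * D -> kappa * N + sigma * D <= V - W ->
    W <= (1 - rho) * V.
Proof.
move=> k0 s0 t0; pose c := Num.min (kappa / 2) (sigma / tau).
have c0 : 0 < c by rewrite lt_min !divr_gt0.
have c1 : 0 < 1 + c by rewrite addr_gt0.
exists (c / (1 + c)).
  by rewrite divr_gt0//= ler_pdivrMr// mul1r lerDr.
move=> V W N D N0 D0 hW hV.
have -> : 1 - c / (1 + c) = (1 + c)^-1 by field; rewrite gt_eqF.
rewrite ler_pdivlMl// mulrDl mul1r -lerBrDl.
apply: le_trans hV; apply: (le_trans (ler_wpM2l (ltW c0) hW)).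
have ck : c * 2 <= kappa by rewrite -ler_pdivlMr// ge_min lexx.
have cs : c * tau <= sigma by rewrite -ler_pdivlMr// ge_min lexx orbT.
rewrite mulrDr !mulrA; apply: lerD; exact: ler_wpM2r.
Qed.

Context (LF muF mur LH : R) (LF_gt0 : 0 < LF) (LH_gt0 : 0 < LH)
  (muF_ge0 : 0 <= muF) (mur_ge0 : 0 <= mur) (mu_gt0 : 0 < muF + mur)
  (gamma_lt : gamma * LF < 2).

(** Strong monotonicity is available for F only with the factor 2 - gamma L_F
    left after absorbing |f|^2; since this factor is below 2 the term of R may be
    weakened to the same factor, and the sum muF + mur appears. *)
Lemma pd3o_contraction : exists2 rho : R, 0 < rho <= 1 &
  forall x f g u v h,
    `|f| ^+ 2 <= LF * inner x f -> muF * `|x| ^+ 2 <= inner x f ->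
    mur * `|x| ^+ 2 <= inner x g -> `|v| ^+ 2 <= LH * inner h v ->
    h = (gamma * eta) *: (u - v) + K (x - gamma *: (f + g + Ks u)) ->
  energy gamma eta (x - gamma *: f - gamma *: Ks v) v <=
  (1 - rho) * energy gamma eta (x + gamma *: g) u.
Proof.
pose eps := 2 - gamma * LF; have eps0 : 0 < eps by rewrite subr_gt0.
have [||| rho rho01 rate] := @contraction_rate (gamma * eps * (muF + mur))
  (2 * gamma / LH) (2 * gamma ^+ 2 * eta).
- by rewrite !mulr_gt0.
- by rewrite divr_gt0// mulr_gt0.
- by rewrite !mulr_gt0// exprn_gt0.
exists rho => // x f g u v h hf hmF hmr hH hh.
have xf0 : 0 <= inner x f by apply: le_trans hmF; rewrite mulr_ge0 ?sqr_ge0.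
apply: (rate _ _ (`|x| ^+ 2) (`|v| ^+ 2)); rewrite ?sqr_ge0//.
  rewrite -(scaleNr gamma (Ks v)); apply: (le_trans (energy_le _ _ (sqrrN gamma))).
  rewrite lerD2r ler_wpM2l//.
  by apply: (gradient_step_nonexpansive (L := LF)); rewrite // ltW.
rewrite (pd3o_energy hh).
have m0 : 0 <= gamma ^+ 2 * (eta * `|u - v| ^+ 2 - `|Ks u - Ks v| ^+ 2).
  by rewrite mulr_ge0 ?sqr_ge0// metric_ge0.
have n0 : 0 <= gamma ^+ 2 * `|g + Ks v| ^+ 2 by rewrite mulr_ge0 ?sqr_ge0.
have {}hH : 2 * gamma / LH * `|v| ^+ 2 <= 2 * gamma * inner h v.
  by rewrite -mulrA ler_wpM2l ?mulr_ge0 ?(ltW gamma_gt0)// ler_pdivrMl.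
have {}hf : gamma ^+ 2 * `|f| ^+ 2 <= gamma ^+ 2 * (LF * inner x f).
  by rewrite ler_wpM2l ?sqr_ge0.
have hF : gamma * eps * (muF * `|x| ^+ 2) <= gamma * eps * inner x f.
  by rewrite ler_wpM2l// mulr_ge0// ltW.
have {}hmr : gamma * (mur * `|x| ^+ 2) <= gamma * inner x g.
  by rewrite ler_wpM2l// ltW.
have hR : gamma * eps * (mur * `|x| ^+ 2) <= 2 * gamma * (mur * `|x| ^+ 2).
  rewrite ler_wpM2r ?mulr_ge0 ?sqr_ge0//.
  by rewrite mulrC ler_wpM2r ?(ltW gamma_gt0)// /eps gerBl mulr_ge0 ?ltW.
move: hF hR; rewrite /eps; lra.
Qed.

(** Strong convexity of F controls y and not b, but b differs from the gradient
    step y - gamma f by gamma (g + K^* v), whose square is also part of the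
    decrease.  Since muF and mur act on different points, the rate uses
    min (gamma eps muF, 1) / 2 + 2 gamma mur. *)
Lemma pddy_contraction : exists2 rho : R, 0 < rho <= 1 &
  forall y f g u v h,
    let b := y - gamma *: (f + g + Ks v) in
    `|f| ^+ 2 <= LF * inner y f -> muF * `|y| ^+ 2 <= inner y f ->
    mur * `|b| ^+ 2 <= inner b g -> `|v| ^+ 2 <= LH * inner h v ->
    h = (gamma * eta) *: (u - v) + K (y + gamma *: (Ks v - Ks u)) ->
  energy gamma eta (b + gamma *: Ks v) v <=
  (1 - rho) * energy gamma eta (y + gamma *: Ks v) u.
Proof.
pose eps := 2 - gamma * LF; have eps0 : 0 < eps by rewrite subr_gt0.
pose theta := Num.min (gamma * eps * muF) 1.
have theta0 : 0 <= theta by rewrite le_min ler01 !mulr_ge0// ltW.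
have thF : theta <= gamma * eps * muF by rewrite ge_min lexx.
have th1 : theta <= 1 by rewrite ge_min lexx orbT.
have [||| rho rho01 rate] := @contraction_rate (theta / 2 + 2 * gamma * mur)
  (2 * gamma / LH) (2 * gamma ^+ 2 * eta).
- have [mur0|mur0] := eqVneq mur 0.
    rewrite mur0 mulr0 addr0 divr_gt0// lt_min ltr01 andbT !mulr_gt0//.
    by move: mu_gt0; rewrite mur0 addr0.
  by rewrite ltr_wpDl ?divr_ge0// !mulr_gt0// lt_neqAle eq_sym mur0.
- by rewrite divr_gt0// mulr_gt0.
- by rewrite !mulr_gt0// exprn_gt0.
exists rho => // y f g u v h b hf hmF hmr hH hh.
have yf0 : 0 <= inner y f by apply: le_trans hmF; rewrite mulr_ge0 ?sqr_ge0.
apply: (rate _ _ (`|b| ^+ 2) (`|v| ^+ 2)); rewrite ?sqr_ge0//.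
  exact: energy_le.
rewrite (pddy_energy f g hh) -/b.
have m0 : 0 <= gamma ^+ 2 * (eta * `|u - v| ^+ 2 - `|Ks u - Ks v| ^+ 2).
  by rewrite mulr_ge0 ?sqr_ge0// metric_ge0.
have {}hH : 2 * gamma / LH * `|v| ^+ 2 <= 2 * gamma * inner h v.
  by rewrite -mulrA ler_wpM2l ?mulr_ge0 ?(ltW gamma_gt0)// ler_pdivrMl.
(* b = (y - gamma f) - gamma (g + K^* v), and the gradient step from y does not
   expand. *)
have hb : `|b| ^+ 2 <= 2 * `|y| ^+ 2 + 2 * (gamma ^+ 2 * `|g + Ks v| ^+ 2).
  have -> : b = (y - gamma *: f) + (- gamma) *: (g + Ks v).
    by apply: inner_ext => z; rewrite /b !innerE; lra.
  apply: le_trans (sqr_normD_le _ _) _.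
  rewrite normrZ exprMn real_normK ?num_real// sqrrN lerD2r ler_wpM2l//.
  by apply: (gradient_step_nonexpansive (L := LF)); rewrite // ltW.
have {}hb : theta / 2 * `|b| ^+ 2 <=
    gamma * eps * muF * `|y| ^+ 2 + gamma ^+ 2 * `|g + Ks v| ^+ 2.
  have n0 : 0 <= gamma ^+ 2 * `|g + Ks v| ^+ 2 by rewrite mulr_ge0 ?sqr_ge0.
  have := ler_wpM2l theta0 hb.
  have := ler_wpM2r (sqr_ge0 `|y|) thF.
  have := ler_wpM2r n0 th1.
  lra.
have {}hf : gamma ^+ 2 * `|f| ^+ 2 <= gamma ^+ 2 * (LF * inner y f).
  by rewrite ler_wpM2l ?sqr_ge0.
have hF : gamma * eps * (muF * `|y| ^+ 2) <= gamma * eps * inner y f.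
  by rewrite ler_wpM2l// mulr_ge0// ltW.
have {}hmr : gamma * (mur * `|b| ^+ 2) <= gamma * inner b g.
  by rewrite ler_wpM2l// ltW.
move: hF hb; rewrite /eps; lra.
Qed.

(** The dual step is firmly nonexpansive, so the energy bounds
    |y|^2 + gamma^2 |K^* v|^2, and b is at most as large as
    (y - gamma f) - gamma K^* v by monotonicity of the subdifferential of R.  This
    gives the factor 2, hence 4. *)
Lemma pddy_primal_bound y f g u v h :
  let b := y - gamma *: (f + g + Ks v) in
  `|f| ^+ 2 <= LF * inner y f -> 0 <= inner y f ->
  0 <= inner b g -> 0 <= inner h v ->
  h = (gamma * eta) *: (u - v) + K (y + gamma *: (Ks v - Ks u)) ->
  `|b| ^+ 2 <= 4 * energy gamma eta (y + gamma *: Ks v) u.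
Proof.
move=> b hf yf0 bg0 hv0 hh.
have E0 := le_trans (sqr_ge0 _) (sqr_norm_le_energy (y + gamma *: Ks v) u).
have hb : `|b| ^+ 2 <= `|b + gamma *: g| ^+ 2.
  move: {hh} (b) bg0 => z zg0.
  have := mulr_ge0 (ltW gamma_gt0) zg0; have := sqr_ge0 (gamma * `|g|).
  rewrite exprMn -!inner_norm !innerE (innerC g z); lra.
have e : b + gamma *: g = (y - gamma *: f) + (- gamma) *: Ks v.
  by apply: inner_ext => z; rewrite /b !innerE; lra.
have := sqr_normD_le (y - gamma *: f) ((- gamma) *: Ks v).
rewrite -e normrZ exprMn real_normK ?num_real// sqrrN => hs.
have hy : `|y - gamma *: f| ^+ 2 <= `|y| ^+ 2.
  by apply: (gradient_step_nonexpansive (L := LF)); rewrite // ltW.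
(* Firm nonexpansiveness of the dual step, from <h, v> >= 0. *)
suff : `|y| ^+ 2 + gamma ^+ 2 * `|Ks v| ^+ 2 <=
    energy gamma eta (y + gamma *: Ks v) u by lra.
have := mulr_ge0 (ltW gamma_gt0) hv0.
have g2 := sqr_ge0 gamma.
have := mulr_ge0 g2 (metric_ge0 u v).
have : 0 <= gamma ^+ 2 * (eta * `|v| ^+ 2 - `|Ks v| ^+ 2).
  by rewrite mulr_ge0// subr_ge0; exact: adjoint_bound.
rewrite hh innerDl hKs /energy -!inner_norm !innerE.
rewrite !(innerC (Ks u)) !(innerC (Ks v)) !(innerC v u); lra.
Qed.

End Energy.

(** * Solutions and convergence of the iterations *)

Section Iterations.
Context {R : realType} {X U : euclideanType R}.
Context (K : {linear X -> U}) (Ks : U -> X) (hKs : adjoint K Ks).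
Context (F : X -> R) (r : X -> \bar R) (H : U -> R).
Context (LF muF mur LH gamma eta : R).
Context (r_proper : proper_ereal r) (r_closed : lower_semicontinuous r)
  (r_convex : convexe r) (r_strong : strongly_convex mur r).
Context (F_convex : convexe (EFin \o F)) (LF_gt0 : 0 < LF) (F_smooth : smooth LF F)
  (F_strong : strongly_convex muF (EFin \o F)).
Context (H_convex : convexe (EFin \o H)) (LH_gt0 : 0 < LH) (H_smooth : smooth LH H).
Context (muF_ge0 : 0 <= muF) (mur_ge0 : 0 <= mur) (mu_gt0 : 0 < muF + mur).
Context (gamma_gt0 : 0 < gamma) (gamma_lt : gamma < 2 / LF)
  (eta_gt0 : 0 < eta) (eta_ge : opnorm K ^+ 2 <= eta).
Context (xs g : X) (us : U) (g_subdiff : subdiff r xs g)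
  (us_grad : us = grad H (K xs)) (kkt : grad F xs + g + Ks us = 0).

Let us_subdiff : subdiff (EFin \o H) (K xs) us.
Proof. by rewrite us_grad; apply: grad_subdiff H_smooth H_convex; exact: ltW. Qed.

Let F_subdiff x : subdiff (EFin \o F) x (grad F x).
Proof. by apply: grad_subdiff F_smooth F_convex; exact: ltW. Qed.

Lemma kkt_inner z : inner (grad F xs) z + inner g z + inner us (K z) = 0.
Proof. by rewrite (innerC us) hKs (innerC z) -!innerDl kkt inner0l. Qed.

(** The three subgradient inequalities at xs add up, their linear terms cancel by
    the optimality condition, and the quadratic term (muF + mur) / 2 remains. *)
Lemma primal_argmin : argmin (primal_obj F r (EFin \o H) K) = [set xs].
Proof.
have rxs := subdiff_fin r_proper g_subdiff.
apply: (@argmin_growth _ _ _ _ ((muF + mur) / 2)).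
- by rewrite /primal_obj !fin_numD rxs.
- by rewrite divr_gt0.
move=> y; have := us_subdiff (K y).
have := strong_subdiff y (proper_EFin F) F_strong (F_subdiff xs).
have := strong_subdiff y r_proper r_strong g_subdiff.
have [rN _] := r_proper; rewrite /primal_obj -(fineK rxs) /=.
case: (r y) (rN y) => [s _| _ _ _ _|//]; last by rewrite addey// addye// leey.
rewrite -!(EFinD) !lee_fin -linearB.
by have := kkt_inner (y - xs); lra.
Qed.

(** Fenchel-Young at xs for F + R, with equality at - K^* us, and the quadratic
    gap of the conjugate of H. *)
Lemma dual_argmin : argmin (dual_obj F r (EFin \o H) Ks) = [set us].
Proof.
have rxs := subdiff_fin r_proper g_subdiff.
pose f x := ((F x)%:E + r x)%E.
have fp : proper_ereal f.
  split=> [x|]; first by have [rN _] := r_proper; rewrite /f; case: (r x) (rN x).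
  by exists xs; rewrite /f fin_numD rxs.
have fs : subdiff f xs (- Ks us).
  have -> : - Ks us = grad F xs + g by apply/eqP; rewrite eq_sym -addr_eq0 kkt.
  move=> y; rewrite /f innerDl EFinD addeACA; apply: leeD; last exact: g_subdiff.
  exact: F_subdiff.
have e1 : conjugate f (- Ks us) = (inner xs (- Ks us) - F xs - fine (r xs))%:E.
  by rewrite (conjugate_subdiff fp fs) /f -(fineK rxs) -EFinD /= opprD addrA.
have e2 := conjugate_subdiff (proper_EFin H) us_subdiff.
apply: (@argmin_growth _ _ _ _ (2 * LH)^-1).
- by rewrite /dual_obj -/f e1 e2.
- by rewrite invr_gt0 mulr_gt0.
move=> u; rewrite /dual_obj -/f e1 e2.
have h1 : ((inner xs (- Ks u) - F xs - fine (r xs))%:E <= conjugate f (- Ks u)%R)%E.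
  apply: le_trans (conjugate_ge _ xs _).
  by rewrite /f -(fineK rxs) -EFinD lee_fin /=; lra.
have h2 := conjugate_growth (K xs) u LH_gt0 H_smooth.
apply: le_trans (leeD h1 h2).
by rewrite -us_grad /= -!EFinD lee_fin !innerNr -!hKs; lra.
Qed.

(** The output u of the dual proximal step is the gradient of H at c (z - u),
    so that cocoercivity of the gradient of H applies. *)
Lemma dual_prox_coercive (c : R) z u : 0 < c ->
  u = prox (scalee c^-1 (conjugate (EFin \o H))) z ->
  `|u - us| ^+ 2 <= LH * inner (c *: (z - u) - K xs) (u - us).
Proof.
move=> c0 eu; have c0' : 0 < c^-1 by rewrite invr_gt0.
have := prox_subdiff z c0' (conjugate_proper (proper_EFin H) us_subdiff)
  (conjugate_lsc (proper_EFin H)) (conjugate_convex (proper_EFin H))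
  (conjugate_minorized (proper_EFin H) us_subdiff).
rewrite -eu invrK => /(subdiff_conjugate_grad LH_gt0 H_smooth H_convex) e.
by have := cocoercive (c *: (z - u)) (K xs) LH_gt0 H_smooth H_convex;
  rewrite -e -us_grad.
Qed.

Lemma primal_prox_subdiff z :
  subdiff r (prox (scalee gamma r) z) (gamma^-1 *: (z - prox (scalee gamma r) z)).
Proof. by apply: prox_subdiff => //; exact: subdiff_minorized g_subdiff. Qed.

Lemma grad_cocoercive x :
  `|grad F x - grad F xs| ^+ 2 <= LF * inner (x - xs) (grad F x - grad F xs).
Proof. exact: cocoercive. Qed.

Lemma grad_strongly_monotone x :
  muF * `|x - xs| ^+ 2 <= inner (x - xs) (grad F x - grad F xs).
Proof. exact: strongly_monotone (proper_EFin F) F_strong _ _. Qed.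

Let gamma_LF : gamma * LF < 2.
Proof. by rewrite -ltr_pdivlMr. Qed.

Lemma pd3o_linear : exists2 rho : R, 0 < rho <= 1 &
  forall (x q : nat -> X) (u : nat -> U),
    PD3O F r (EFin \o H) K Ks (fun=> gamma) eta x q u ->
    forall k : nat,
      `|x k.+1 - xs| ^+ 2 <= (1 - rho) ^+ k * energy Ks gamma eta
        (gamma *: q 0%N - xs + gamma *: grad F xs - gamma *: Ks (u 0%N - us))
        (u 0%N - us).
Proof.
have [rho /andP[rho0 rho1] contr] := pd3o_contraction hKs gamma_gt0 eta_gt0 eta_ge
  LF_gt0 LH_gt0 muF_ge0 mur_ge0 mu_gt0 gamma_LF.
exists rho => [|x q u alg k]; first by rewrite rho0.
pose V k := energy Ks gamma eta
  (gamma *: q k - xs + gamma *: grad F xs - gamma *: Ks (u k - us)) (u k - us).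
have gV : gamma != 0 by rewrite gt_eqF.
have step j : `|x j.+1 - xs| ^+ 2 <= V j /\ V j.+1 <= (1 - rho) * V j.
  have [ex eq eu] := alg j.
  pose dx := x j.+1 - xs; pose df := grad F (x j.+1) - grad F xs.
  have [y ysub gy] : exists2 y, subdiff r (x j.+1) y & forall z,
      gamma * inner y z = gamma * (inner (q j) z - inner (Ks (u j)) z)
        - inner (x j.+1) z.
    exists (gamma^-1 *: (gamma *: (q j - Ks (u j)) - x j.+1)) => [|z].
      by rewrite ex; exact: primal_prox_subdiff.
    by rewrite !innerE mulVKf.
  pose dg := y - g.
  have dxg : mur * `|dx| ^+ 2 <= inner dx dg.
    exact: strongly_monotone r_proper r_strong ysub g_subdiff.
  have gq z : gamma * inner (q j.+1) z =
      inner (x j.+1) z - gamma * inner (grad F (x j.+1)) z.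
    by rewrite eq !innerE mulrBr mulVKf.
  have kz z : inner (grad F xs) z = - inner g z - inner (Ks us) z.
    have := congr1 (inner^~ z) kkt; rewrite !innerE; lra.
  have eV : V j = energy Ks gamma eta (dx + gamma *: dg) (u j - us).
    congr energy; apply: inner_ext => z.
    by have := gy z; rewrite /dx /dg (adjointB hKs) !innerE kz; lra.
  have eV1 : V j.+1 = energy Ks gamma eta
      (dx - gamma *: df - gamma *: Ks (u j.+1 - us)) (u j.+1 - us).
    congr energy; apply: inner_ext => z.
    by have := gq z; rewrite /dx /df !innerE; lra.
  have xg0 : 0 <= inner dx dg.
    by apply: le_trans dxg; rewrite mulr_ge0 ?sqr_ge0.
  split.
    rewrite eV; apply: le_trans (sqr_norm_le_energy hKs gamma eta_ge _ _).
    have := mulr_ge0 (ltW gamma_gt0) xg0; have := sqr_ge0 (gamma * `|dg|).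
    rewrite -/dx exprMn; move: (dx) (dg) => a b.
    by rewrite -!inner_norm !innerE (innerC b a); lra.
  rewrite eV eV1.
  have ge0 : 0 < gamma * eta by rewrite mulr_gt0.
  have := dual_prox_coercive ge0 eu; set h := _ - K xs => hco.
  apply: (contr dx df dg (u j - us) _ h) => //.
  - exact: grad_cocoercive.
  - exact: grad_strongly_monotone.
  rewrite /h [u j + _ - _]addrAC scalerDr scalerA mulfK ?gt_eqF// -linearZ/=.
  apply: inner_ext => z; rewrite !(innerDl, innerNl) !hKs.
  have := gq (Ks z); have := gy (Ks z).
  have := mulVKf gV (inner (x j.+1) (Ks z)).
  by rewrite /dx /df /dg (adjointB hKs) !innerE kz; lra.
have V0 j : 0 <= V j by apply: le_trans (proj1 (step j)); exact: sqr_ge0.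
apply: le_trans (proj1 (step k)) _; rewrite -/(V 0%N).
elim: k => [|k IH]; first by rewrite mul1r.
apply: le_trans (proj2 (step k)) _; by rewrite exprS -mulrA ler_wpM2l// subr_ge0.
Qed.

Lemma pddy_linear : exists2 rho : R, 0 < rho <= 1 &
  forall (xr x p : nat -> X) (u : nat -> U),
    PDDY F r (EFin \o H) K Ks (fun=> gamma) eta xr x p u ->
    forall k : nat,
      `|xr k.+1 - xs| ^+ 2 <= 4 * (1 - rho) ^+ k * energy Ks gamma eta
        (xr 0%N - xs + gamma *: Ks (u 0%N - us)) (u 0%N - us).
Proof.
have [rho /andP[rho0 rho1] contr] := pddy_contraction hKs gamma_gt0 eta_gt0 eta_ge
  LH_gt0 muF_ge0 mur_ge0 mu_gt0 gamma_LF.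
exists rho => [|xr x p u [p0 alg] k]; first by rewrite rho0.
pose V k := energy Ks gamma eta (xr k - xs + gamma *: Ks (u k - us)) (u k - us).
have gV : gamma != 0 by rewrite gt_eqF.
have ep j : p j = Ks (u j) by case: j => [//|j]; have [] := alg j.
have step j : `|xr j.+1 - xs| ^+ 2 <= 4 * V j /\ V j.+1 <= (1 - rho) * V j.
  have [eu _ ex exr] := alg j; rewrite !ep in ex exr.
  pose dx := x j.+1 - xs; pose df := grad F (x j.+1) - grad F xs.
  have [y ysub gy] : exists2 y, subdiff r (xr j.+1) y & forall z,
      gamma * inner y z = inner (x j.+1) z - gamma * inner (grad F (x j.+1)) z
        - gamma * inner (Ks (u j.+1)) z - inner (xr j.+1) z.
    exists (gamma^-1 *: (x j.+1 - gamma *: grad F (x j.+1)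
        - gamma *: Ks (u j.+1) - xr j.+1)) => [|z].
      by rewrite exr; exact: primal_prox_subdiff.
    by rewrite !innerE mulVKf.
  pose dg := y - g.
  have dxg : mur * `|xr j.+1 - xs| ^+ 2 <= inner (xr j.+1 - xs) dg.
    exact: strongly_monotone r_proper r_strong ysub g_subdiff.
  have kz z : inner (grad F xs) z = - inner g z - inner (Ks us) z.
    have := congr1 (inner^~ z) kkt; rewrite !innerE; lra.
  have eb : xr j.+1 - xs = dx - gamma *: (df + dg + Ks (u j.+1 - us)).
    apply: inner_ext => z; have := gy z.
    by rewrite /dx /df /dg (adjointB hKs) !innerE kz; lra.
  have eV : V j = energy Ks gamma eta (dx + gamma *: Ks (u j.+1 - us)) (u j - us).
    congr energy; apply: inner_ext => z.
    by rewrite /dx ex !(adjointB hKs) !innerE; lra.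
  have ge0 : 0 < gamma * eta by rewrite mulr_gt0.
  have := dual_prox_coercive ge0 eu; set h := _ - K xs => hco.
  have hh : h = (gamma * eta) *: (u j - us - (u j.+1 - us))
      + K (dx + gamma *: (Ks (u j.+1 - us) - Ks (u j - us))).
    rewrite /h [u j + _ - _]addrAC scalerDr scalerA mulfV ?gt_eqF// scale1r.
    apply: inner_ext => z; rewrite !(innerDl, innerNl) !hKs.
    by rewrite /dx ex !(adjointB hKs) !innerE; lra.
  have hf := grad_cocoercive (x j.+1).
  have hF := grad_strongly_monotone (x j.+1).
  rewrite eV; split; last first.
    by rewrite /V eb; apply: contr hh => //; rewrite -eb.
  rewrite eb; apply: (pddy_primal_bound hKs gamma_gt0 eta_ge gamma_LF) hh => //.
  - by apply: le_trans hF; rewrite mulr_ge0 ?sqr_ge0.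
  - by rewrite -eb; apply: le_trans dxg; rewrite mulr_ge0 ?sqr_ge0.
  - by rewrite -(pmulr_rge0 _ LH_gt0); apply: le_trans hco; exact: sqr_ge0.
apply: le_trans (proj1 (step k)) _; rewrite -/(V 0%N) -mulrA ler_wpM2l//.
elim: k => [|k IH]; first by rewrite mul1r.
by apply: le_trans (proj2 (step k)) _; rewrite exprS -mulrA ler_wpM2l// subr_ge0.
Qed.

End Iterations.

Theorem theorem5 (R : realType) (X U : euclideanType R)
  (K : {linear X -> U}) (Ks : U -> X) (hKs : adjoint K Ks)
  (F : X -> R) (r : X -> \bar R) (H : U -> \bar R)
  (LF muF mur LH gamma eta : R)
  (r_proper : proper_ereal r) (r_closed : lower_semicontinuous r)
  (r_convex : convexe r)
  (H_proper : proper_ereal H) (H_closed : lower_semicontinuous H)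
  (H_convex : convexe H)
  (F_convex : convexe (EFin \o F)) (LF_gt0 : 0 < LF) (F_smooth : smooth LF F)
  (standing : exists xs g h, subdiff r xs g /\ subdiff H (K xs) h /\
     grad F xs + g + Ks h = 0)
  (muF_ge0 : 0 <= muF) (F_strong : strongly_convex muF (EFin \o F))
  (mur_ge0 : 0 <= mur) (r_strong : strongly_convex mur r)
  (mu_gt0 : 0 < muF + mur)
  (LH_gt0 : 0 < LH) (H_smooth : smoothe LH H)
  (gamma_gt0 : 0 < gamma) (gamma_lt : gamma < 2 / LF)
  (eta_gt0 : 0 < eta) (eta_ge : opnorm K ^+ 2 <= eta) :
  exists (xs : X) (us : U),
    [/\ argmin (primal_obj F r H K) = [set xs],
        argmin (dual_obj F r H Ks) = [set us],
        (exists2 rho : R, 0 < rho <= 1 &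
           forall (x q : nat -> X) (u : nat -> U),
             PD3O F r H K Ks (fun=> gamma) eta x q u ->
             forall k : nat,
               `|x k.+1 - xs| ^+ 2 <=
               (1 - rho) ^+ k *
               (`|gamma *: q 0%N - xs + gamma *: grad F xs
                  - gamma *: Ks (u 0%N - us)| ^+ 2
                + gamma ^+ 2 * eta * `|u 0%N - us| ^+ 2
                - gamma ^+ 2 * `|Ks (u 0%N - us)| ^+ 2))
      & (exists2 rho : R, 0 < rho <= 1 &
           forall (xr x p : nat -> X) (u : nat -> U),
             PDDY F r H K Ks (fun=> gamma) eta xr x p u ->
             forall k : nat,
               `|xr k.+1 - xs| ^+ 2 <=
               4 * (1 - rho) ^+ k *
               (`|xr 0%N - xs + gamma *: Ks (u 0%N - us)| ^+ 2
                + gamma ^+ 2 * eta * `|u 0%N - us| ^+ 2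
                - gamma ^+ 2 * `|Ks (u 0%N - us)| ^+ 2))].
Proof.
have [h eH h_smooth] := H_smooth.
have [xs [g [us [g_subdiff [us_subdiff kkt]]]]] := standing; subst H.
have us_grad := subdiff_grad LH_gt0 h_smooth us_subdiff.
exists xs, us; split.
- exact: (primal_argmin hKs r_proper r_strong F_convex LF_gt0 F_smooth F_strong
    H_convex LH_gt0 h_smooth mu_gt0 g_subdiff us_grad kkt).
- exact: (dual_argmin hKs r_proper F_convex LF_gt0 F_smooth H_convex LH_gt0
    h_smooth g_subdiff us_grad kkt).
- exact: (pd3o_linear hKs r_proper r_closed r_convex r_strong F_convex LF_gt0
    F_smooth F_strong H_convex LH_gt0 h_smooth muF_ge0 mur_ge0 mu_gt0 gamma_gt0
    gamma_lt eta_gt0 eta_ge g_subdiff us_grad kkt).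
- exact: (pddy_linear hKs r_proper r_closed r_convex r_strong F_convex LF_gt0
    F_smooth F_strong H_convex LH_gt0 h_smooth muF_ge0 mur_ge0 mu_gt0 gamma_gt0
    gamma_lt eta_gt0 eta_ge g_subdiff us_grad kkt).
Qed.
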